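(* Let $\alpha\in[\tfrac{1}{2},\tfrac{3}{4})$ and let $t$ be a positive integer. Let $G$ be a connected graph of order $$n\geq\max\left\{5t^{2}+10t+1,\ \frac{12t(1-\alpha)-2\alpha+1}{3-4\alpha}\right\}.$$ If $\rho_{\alpha}(G)\geq\rho_{\alpha}(K_{2t-1}\vee(K_{n-2t}\cup K_1))$, then $G$ is $t$-tough unless $G=K_{2t-1}\vee(K_{n-2t}\cup K_1)$.
   Context: All graphs are finite, simple and undirected. For a graph $G$ with adjacency matrix $A(G)$ and diagonal degree matrix $D(G)$, and $\alpha\in[0,1]$, the $A_{\alpha}$-matrix is $A_{\alpha}(G)=\alpha D(G)+(1-\alpha)A(G)$, and $\rho_{\alpha}(G)$ denotes its largest eigenvalue (the $A_{\alpha}$-spectral radius). For a real $t\geq 0$, $G$ is $t$-tough if $|S|\geq t\,c(G-S)$ for every $S\subseteq V(G)$ with $c(G-S)\geq 2$, where $c(G-S)$ is the number of connected components of $G-S$. $K_m$ is the complete graph on $m$ vertices; $G_1\cup G_2$ is the disjoint union and $G_1\vee G_2$ the join (disjoint union plus all edges between $V(G_1)$ and $V(G_2)$). *)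

(* Defs.v *)
From mathcomp Require Import all_boot all_order all_algebra.
From mathcomp Require Import classical_sets reals.

Set Implicit Arguments.
Unset Strict Implicit.
Unset Printing Implicit Defensive.

Import Order.TTheory GRing.Theory Num.Theory.

Local Open Scope ring_scope.

Record sgraph := SGraph {
  vertex :> finType;
  adj : rel vertex;
  adj_sym : symmetric adj;
  adj_irr : irreflexive adj }.

Section Constructions.

Lemma complete_sym m : symmetric (fun i j : 'I_m => i != j).
Proof. by move=> i j; rewrite eq_sym. Qed.

Lemma complete_irr m : irreflexive (fun i j : 'I_m => i != j).
Proof. by move=> i; rewrite eqxx. Qed.

Definition complete_graph (m : nat) : sgraph :=
  SGraph (@complete_sym m) (@complete_irr m).

Variables G1 G2 : sgraph.

Definition dunion_adj : rel (G1 + G2)%type := fun x y =>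
  match x, y with
  | inl x, inl y => adj x y
  | inr x, inr y => adj x y
  | _, _ => false
  end.

Lemma dunion_sym : symmetric dunion_adj.
Proof. by move=> [x|x] [y|y] //=; exact: adj_sym. Qed.

Lemma dunion_irr : irreflexive dunion_adj.
Proof. by move=> [x|x] /=; exact: adj_irr. Qed.

Definition dunion_graph : sgraph := SGraph dunion_sym dunion_irr.

Definition join_adj : rel (G1 + G2)%type := fun x y =>
  match x, y with
  | inl x, inl y => adj x y
  | inr x, inr y => adj x y
  | _, _ => true
  end.

Lemma join_sym : symmetric join_adj.
Proof. by move=> [x|x] [y|y] //=; exact: adj_sym. Qed.

Lemma join_irr : irreflexive join_adj.
Proof. by move=> [x|x] /=; exact: adj_irr. Qed.

Definition join_graph : sgraph := SGraph join_sym join_irr.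

End Constructions.

Section Deletion.

Variables (G : sgraph) (S : {set G}).

Definition delete_adj : rel {x : G | x \notin S} :=
  fun x y => adj (val x) (val y).

Lemma delete_sym : symmetric delete_adj.
Proof. by move=> x y; exact: adj_sym. Qed.

Lemma delete_irr : irreflexive delete_adj.
Proof. by move=> x; exact: adj_irr. Qed.

Definition delete : sgraph := SGraph delete_sym delete_irr.

End Deletion.

Definition isomorphic (G H : sgraph) : Prop :=
  exists2 f : G -> H, bijective f & forall x y, adj (f x) (f y) = adj x y.

Definition components (G : sgraph) : nat := n_comp (@adj G) G.

Definition connected_graph (G : sgraph) : Prop := components G = 1%N.

Definition tough (R : realType) (t : R) (G : sgraph) : Prop :=
  forall S : {set G}, (2 <= components (delete S))%N ->
    t * (components (delete S))%:R <= #|S|%:R.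

Section Spectrum.

Variables (R : realType) (G : sgraph).

Definition degree (x : G) : nat := #|[set y | adj x y]|.

Definition adjacency_mx : 'M[R]_#|G| :=
  \matrix_(i, j) (adj (enum_val i) (enum_val j))%:R.

Definition degree_mx : 'M[R]_#|G| :=
  diag_mx (\row_i (degree (enum_val i))%:R).

Definition Aalpha (alpha : R) : 'M[R]_#|G| :=
  alpha *: degree_mx + (1 - alpha) *: adjacency_mx.

(* The matrix is real symmetric, so for a nonempty graph its set of real
   eigenvalues is finite and nonempty, and the supremum is its maximum. *)
Definition rho (alpha : R) : R :=
  sup [set x : R | eigenvalue (Aalpha alpha) x]%classic.

End Spectrum.

Definition extremal (n t : nat) : sgraph :=
  join_graph (complete_graph (2 * t - 1)) (dunion_graph (complete_graph (n - 2 * t)) (complete_graph 1)).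

(* Main.v *)
(* A positive function w with A_alpha w <= lambda w bounds every eigenvalue by
   lambda, strictly so if the inequality is strict everywhere, or if it is
   strict somewhere and the graph is connected.
   Suppose |S| < t c with c = c(G - S) >= 2.  If some vertex of G has degree at
   most 2t - 1, then G is a spanning subgraph of the extremal graph, whose
   positive eigenvector, lifted from the 3 by 3 quotient matrix, serves as w.
   Otherwise every vertex of G - S misses at least d + 1 other vertices of G - S,
   d = max(1, c - 2), and a w equal to 1 on S and to a constant 1 - u off S gives
   rho(G) < n - 2, whereas the extremal graph contains K_(n-1) and has spectral
   radius at least n - 2. *)
Require Import Defs.
From mathcomp Require Import all_boot all_order all_algebra.
From mathcomp Require Import classical_sets reals.
From mathcomp Require Import zify ring lra.

Import Order.TTheory GRing.Theory Num.Theory.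
Local Open Scope ring_scope.

(** * The matrix as an operator on vertex functions *)

(** The diagonal term [alpha * degree x * f x] is spread over the neighbours, so that each edge at
    [x] gives one summand. *)
Definition Aalpha_op {R : realType} {G : sgraph} (alpha : R) (f : G -> R)
    (x : G) : R :=
  \sum_(y | adj x y) (alpha * f x + (1 - alpha) * f y).

(** [eigenvalue] refers to row vectors; symmetry of [adj] turns the resulting column sums into sums
    over neighbours. *)
Lemma mul_row_Aalpha (R : realType) (G : sgraph) (alpha : R)
    (v : 'rV[R]_#|G|) (x : G) :
  (v *m Aalpha G alpha) 0 (enum_rank x)
  = Aalpha_op alpha (fun y => v 0 (enum_rank y)) x.
Proof.
rewrite /Aalpha mulmxDr -!scalemxAr mxE [X in X + _]mxE [X in _ + X]mxE.
rewrite mul_mx_diag mxE mxE enum_rankK mxE.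
rewrite /Aalpha_op big_split /= sumr_const -mulr_sumr; congr (_ + _ * _).
  by rewrite -[RHS]mulr_natr /degree cardsE; ring.
rewrite (reindex enum_rank) /=; last first.
  by exists enum_val => y _; rewrite (enum_rankK, enum_valK).
rewrite [RHS]big_mkcond /=; apply: eq_bigr => y _.
by rewrite mxE !enum_rankK adj_sym; case: ifP; rewrite ?mulr1 ?mulr0.
Qed.

Lemma eigenvalue_AalphaP (R : realType) (G : sgraph) (alpha a : R) :
  eigenvalue (Aalpha G alpha) a <->
  exists2 f : G -> R, exists x, f x != 0 &
    forall x, Aalpha_op alpha f x = a * f x.
Proof.
split=> [/eigenvalueP[v vA /rV0Pn[i vi]]|[f [x fx] fA]].
  exists (fun y => v 0 (enum_rank y)).
    by exists (enum_val i); rewrite enum_valK.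
  by move=> x; rewrite -mul_row_Aalpha vA mxE.
apply/eigenvalueP; exists (\row_i f (enum_val i)); last first.
  by apply/rV0Pn; exists (enum_rank x); rewrite mxE enum_rankK.
apply/rowP => i; rewrite -[i]enum_valK mul_row_Aalpha !mxE !enum_rankK -fA.
by apply: eq_bigr => y _; rewrite !mxE !enum_rankK.
Qed.

(** A supremum of values below [lambda] need only be at most [lambda]; finiteness of the root set
    supplies a uniform bound [mu]. Roots are split off one at a time. *)
Lemma root_lt_bound (R : realFieldType) (p : {poly R}) (lambda : R) :
  p != 0 -> (forall x, root p x -> x < lambda) ->
  exists2 mu, mu < lambda & forall x, root p x -> x <= mu.
Proof.
have [k] := ubnP (size p); elim: k p => // k IHk p lek p0 plt.
have noroot : (forall x, root p x -> False) ->
    exists2 mu, mu < lambda & forall x, root p x -> x <= mu.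
  by move=> H; exists (lambda - 1) => [|x /H//]; rewrite ltrBlDr ltrDl.
have [[x px]|] := boolp.pselect (exists x, root p x); last first.
  by move=> H; apply: noroot => x px; apply: H; exists x.
have /factor_theorem[q pE] := px.
have q0 : q != 0 by apply: contraNneq p0 => q0; rewrite pE q0 mul0r.
have [|//|y qy|mu mult qmu] := IHk q.
- by move: lek; rewrite pE size_Mmonic ?monicXsubC // size_XsubC addn2.
- by apply: plt; rewrite pE rootM qy.
exists (Num.max x mu); first by rewrite gt_max plt.
move=> y; rewrite pE rootM root_XsubC le_max => /orP[/qmu->|/eqP->].
  by rewrite orbT.
by rewrite lexx.
Qed.

Lemma rho_lt (R : realType) (G : sgraph) (alpha lambda : R) :
  0 < lambda -> (forall a, eigenvalue (Aalpha G alpha) a -> a < lambda) ->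
  rho G alpha < lambda.
Proof.
move=> l0 elt; rewrite /rho; set E := [set x | _]%classic.
(* The supremum of the empty set is 0 by convention; this case uses [0 < lambda]. *)
have [->|/set0P E0] := eqVneq E set0; first by rewrite sup0.
have [||mu mult rmu] := @root_lt_bound R (char_poly (Aalpha G alpha)) lambda.
- by apply: monic_neq0; apply: char_poly_monic.
- by move=> x; rewrite -eigenvalue_root_char; apply: elt.
apply: le_lt_trans mult; apply: ge_sup => // x /= Ex.
by apply: rmu; rewrite -eigenvalue_root_char.
Qed.

(** * Bounds from positive supersolutions *)

Section CollatzWielandt.

Variables (R : realType) (G : sgraph) (alpha lambda : R) (w : G -> R).
Hypotheses (alpha_ge0 : 0 <= alpha) (alpha_lt1 : alpha < 1).
Hypothesis w_gt0 : forall x, 0 < w x.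
Hypothesis w_super : forall x, Aalpha_op alpha w x <= lambda * w x.

(** Where [|f| / w] attains its maximum [r], the triangle inequality gives [lambda * r * w x <= |a *
    f x| <= r * Aalpha_op alpha w x <= r * lambda * w x]. Equality holds throughout, and since
    [1 - alpha > 0] every neighbour is a maximizer too. *)
Lemma eigenfunction_maximizer (a : R) (f : G -> R) (r : R) (x : G) :
  0 < r -> lambda <= a -> (forall y, Aalpha_op alpha f y = a * f y) ->
  (forall y, `|f y| <= r * w y) -> `|f x| = r * w x ->
  Aalpha_op alpha w x = lambda * w x /\
  forall y, adj x y -> `|f y| = r * w y.
Proof.
move=> r0 la fA fle fx.
have a1 : 0 <= 1 - alpha by rewrite subr_ge0 ltW.
(* The slack contributed by a neighbour [y]: nonnegative, with total 0 over the neighbours of [x],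
   hence 0 for each of them. *)
pose D y := alpha * (r * w x) + (1 - alpha) * (r * w y)
  - (alpha * `|f x| + (1 - alpha) * `|f y|).
have D0 y : 0 <= D y by rewrite /D fx; have := ler_wpM2l a1 (fle y); lra.
have up : r * Aalpha_op alpha w x <= r * (lambda * w x).
  by rewrite ler_pM2l.
have lo : r * (lambda * w x) <= \sum_(y | adj x y)
    (alpha * `|f x| + (1 - alpha) * `|f y|).
  apply: (@le_trans _ _ `|a * f x|).
    rewrite normrM fx mulrCA ler_pM2r ?mulr_gt0 //.
    by apply: le_trans la (ler_norm _).
  rewrite -fA; apply: le_trans (ler_norm_sum _ _ _) _; apply: ler_sum => y _.
  apply: le_trans (ler_normD _ _) _.
  by rewrite !normrM (ger0_norm alpha_ge0) (ger0_norm a1).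
have sumD : \sum_(y | adj x y) D y = r * Aalpha_op alpha w x -
    \sum_(y | adj x y) (alpha * `|f x| + (1 - alpha) * `|f y|).
  rewrite sumrB; congr (_ - _); rewrite mulr_sumr; apply: eq_bigr => y _.
  by ring.
have sD0 : 0 <= \sum_(y | adj x y) D y by apply: sumr_ge0.
split.
  by apply: (@mulfI _ r); [rewrite gt_eqF|lra].
have /eqP : \sum_(y | adj x y) D y = 0 by lra.
rewrite psumr_eq0 // => /allP H y xy.
have := H y (mem_index_enum _); rewrite xy /= => /eqP; rewrite /D fx.
move=> H'; have : (1 - alpha) * (r * w y) = (1 - alpha) * `|f y| by lra.
by move/mulfI => -> //; rewrite subr_eq0 gt_eqF.
Qed.

Lemma eigenfunction_max_exists (f : G -> R) :
  (exists x, f x != 0) ->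
  exists r x, [/\ 0 < r, forall y, `|f y| <= r * w y & `|f x| = r * w x].
Proof.
move=> [x0 fx0].
case: (@arg_maxP _ _ G x0 predT (fun x => `|f x| / w x)) => // x _ xmax.
exists (`|f x| / w x), x; split.
- by apply: lt_le_trans (xmax x0 isT); rewrite divr_gt0 ?normr_gt0.
- by move=> y; rewrite -ler_pdivrMr //; apply: xmax.
- by rewrite divfK // gt_eqF.
Qed.

Lemma rho_lt_strict : 0 < lambda ->
  (forall x, Aalpha_op alpha w x < lambda * w x) -> rho G alpha < lambda.
Proof.
move=> l0 H; apply: rho_lt => // a /eigenvalue_AalphaP[f f0 fA].
rewrite ltNge; apply/negP => la.
have [r [x [r0 fle fx]]] := eigenfunction_max_exists f f0.
have [E _] := eigenfunction_maximizer a f r x r0 la fA fle fx.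
by have := H x; rewrite E ltxx.
Qed.

Lemma rho_lt_connected : 0 < lambda -> connected_graph G ->
  (exists x, Aalpha_op alpha w x < lambda * w x) -> rho G alpha < lambda.
Proof.
move=> l0 Gc [z Hz]; apply: rho_lt => // a /eigenvalue_AalphaP[f f0 fA].
rewrite ltNge; apply/negP => la.
have [r [x [r0 fle fx]]] := eigenfunction_max_exists f f0.
have step y := eigenfunction_maximizer a f r y r0 la fA fle.
have xz : connect (@adj G) x z.
  have cs : connect_sym (@adj G) by apply/sym_connect_sym/adj_sym.
  apply: contra_eqT Gc => nxz; rewrite /components gtn_eqF //.
  apply/card_gt1P.
  exists (fingraph.root (@adj G) x), (fingraph.root (@adj G) z).
  by rewrite !inE !roots_root //= root_connect.
(* Maximality spreads along a path from [x] to [z], where strictness contradicts it. *)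
have : `|f z| = r * w z.
  move/connectP: xz => [p]; elim: p x fx => [|y p IHp] x fx /=.
    by move=> _ ->.
  by move=> /andP[xy yp] zE; apply: (IHp y) => //; apply: (step x fx).2.
by move=> /step[E _]; move: Hz; rewrite E ltxx.
Qed.

End CollatzWielandt.

(** [sup] dominates the eigenvalues once they are bounded above. The constant 1 is a strict
    supersolution for [#|G| + 1], since its image is the degree. *)
Lemma eigenvalue_le_rho (R : realType) (G : sgraph) (alpha a : R) :
  0 <= alpha -> alpha < 1 -> eigenvalue (Aalpha G alpha) a -> a <= rho G alpha.
Proof.
move=> a0 a1 Ea; apply: ub_le_sup => //.
exists (#|G|%:R + 1) => b /= /eigenvalue_AalphaP[f f0 fA].
pose w (_ : G) : R := 1.
have wlt x : Aalpha_op alpha w x < (#|G|%:R + 1) * w x.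
  rewrite /Aalpha_op /w sumr_const mulr1 mulr1 mulr1 addrC subrK.
  by rewrite ltr_pwDr // ler_nat max_card.
rewrite leNgt; apply/negP => /ltW lb.
have wle x := ltW (wlt x).
have w0 x : 0 < w x by exact: ltr01.
have [r [x [r0 fle fx]]] := eigenfunction_max_exists _ _ w w0 f f0.
have [E _] :=
  eigenfunction_maximizer _ _ _ _ w a0 a1 w0 wle b f r x r0 lb fA fle fx.
by have := wlt x; rewrite E ltxx.
Qed.

(** * Joins, unions and the extremal eigenvector *)

Section Operations.

Variables (R : realType) (alpha : R).

Lemma Aalpha_op_join_inl (G1 G2 : sgraph) (w : join_graph G1 G2 -> R) (x : G1) :
  Aalpha_op alpha w (inl x) = Aalpha_op alpha (w \o inl) x +
    \sum_(y : G2) (alpha * w (inl x) + (1 - alpha) * w (inr y)).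
Proof. by rewrite /Aalpha_op big_sumType. Qed.

Lemma Aalpha_op_join_inr (G1 G2 : sgraph) (w : join_graph G1 G2 -> R) (x : G2) :
  Aalpha_op alpha w (inr x) = Aalpha_op alpha (w \o inr) x +
    \sum_(y : G1) (alpha * w (inr x) + (1 - alpha) * w (inl y)).
Proof. by rewrite addrC /Aalpha_op big_sumType. Qed.

Lemma Aalpha_op_dunion_inl (G1 G2 : sgraph) (w : dunion_graph G1 G2 -> R)
    (x : G1) :
  Aalpha_op alpha w (inl x) = Aalpha_op alpha (w \o inl) x.
Proof. rewrite /Aalpha_op big_sumType -[RHS]addr0; congr (_ + _).
exact: big_pred0. Qed.

Lemma Aalpha_op_dunion_inr (G1 G2 : sgraph) (w : dunion_graph G1 G2 -> R)
    (x : G2) :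
  Aalpha_op alpha w (inr x) = Aalpha_op alpha (w \o inr) x.
Proof. rewrite /Aalpha_op big_sumType -[RHS]add0r; congr (_ + _).
exact: big_pred0. Qed.

Lemma sum_const_card (T : finType) (b : R) : \sum_(x : T) b = #|T|%:R * b.
Proof. by rewrite sumr_const -[LHS]mulr_natl. Qed.

Lemma Aalpha_op_complete (m : nat) (w : complete_graph m -> R) (b : R)
    (i : complete_graph m) :
  (forall j, w j = b) -> Aalpha_op alpha w i = (m%:R - 1) * b.
Proof.
move=> wb; rewrite /Aalpha_op wb.
under eq_bigr do rewrite wb -mulrDl addrC subrK mul1r.
rewrite sumr_const -[LHS]mulr_natl; congr (_ * _).
rewrite (eq_card (B := predC1 i)); last by move=> j; rewrite !inE eq_sym.
have := cardC1 i; rewrite card_ord => ->.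
by case: m i {w wb} => [[]//|m] i; rewrite -natr1 addrK.
Qed.

End Operations.

(** The eigenvector is constant on each of the three cliques. The intermediate value theorem locates
    the excess [e] of the eigenvalue over [s + m - 1] in [[0, 1]], which also gives the lower bound
    on [lambda]. *)
Lemma join_perron (R : realType) (alpha : R) (s m : nat) :
  0 <= alpha -> alpha < 1 -> (0 < s)%N -> (0 < m)%N ->
  let G := join_graph (complete_graph s)
             (dunion_graph (complete_graph m) (complete_graph 1)) in
  exists (lambda : R) (w : G -> R),
  [/\ s%:R + m%:R - 1 <= lambda, forall x, 0 < w x &
      forall x, Aalpha_op alpha w x = lambda * w x].
Proof.
move=> a0 a1 s0 m0 G.
have S1 : 1 <= s%:R :> R by rewrite ler1n.
have M1 : 1 <= m%:R :> R by rewrite ler1n.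
set S : R := s%:R in S1 *; set M : R := m%:R in M1 *.
have S0 : 0 < S by lra.
have M0 : 0 <= M by lra.
have b0 : 0 < 1 - alpha by rewrite subr_gt0.
pose k := (1 - alpha) * S.
have k0 : 0 < k by rewrite mulr_gt0.
have b0' := ltW b0; have k0' := ltW k0.
have Mk0 : 0 <= M - 1 + k by lra.
(* [p.[e] = 0] is the equation of the 3 by 3 quotient matrix for the
   eigenvalue [s + m - 1 + e]. *)
pose P : {poly R} := 'X + k%:P.
pose Q : {poly R} := 'X + (M - 1 + k)%:P.
pose p : {poly R} :=
  (('X - alpha%:P) * P + ((1 - alpha) * M)%:P * 'X) * Q
  - ((1 - alpha) * k)%:P * P.
have pE e : p.[e] = ((e - alpha) * (e + k) + (1 - alpha) * M * e)
    * (e + (M - 1 + k)) - (1 - alpha) * k * (e + k).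
  by rewrite /p /P /Q !hornerE.
have [|e /andP[e0 e1] /rootP] := @poly_ivt _ p 0 1 ler01.
  rewrite !pE; apply/andP; split.
    (* These two terms add up to [- p.[0]]. *)
    have h1 : 0 <= alpha * k * (M - 1 + k) by rewrite !mulr_ge0.
    have h2 : 0 <= (1 - alpha) * k * k by rewrite !mulr_ge0.
    lra.
  (* These two terms add up to [p.[1]]. *)
  have h1 : 0 <= (1 - alpha) * (1 + k) * M by rewrite !mulr_ge0 //; lra.
  have h2 : 0 <= (1 - alpha) * M * (M + k) by rewrite !mulr_ge0 //; lra.
  lra.
rewrite pE => pe.
have P0 : 0 < e + k by lra.
have Q0 : 0 < e + (M - 1 + k) by lra.
(* With value 1 on the [s]-clique, the eigenvalue equations on the other two parts force these
   values. *)
pose w (x : G) : R := match x with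
  | inl _ => 1 | inr (inl _) => k / (e + k)
  | inr (inr _) => k / (e + (M - 1 + k)) end.
exists (S + M - 1 + e), w; split.
- by lra.
- by case=> [i|[i|i]] /=; rewrite ?divr_gt0.
move=> [i|[i|i]].
- rewrite Aalpha_op_join_inl (@Aalpha_op_complete _ _ _ _ 1) //.
  rewrite big_sumType /= !sum_const_card !card_ord -/S -/M.
  apply: (@mulIf _ ((e + k) * (e + (M - 1 + k)))).
    by rewrite mulf_neq0 ?gt_eqF.
  rewrite -[RHS]subr0 -[X in _ = _ - X]pe /k; field.
  by rewrite -/k ?gt_eqF.
- rewrite Aalpha_op_join_inr Aalpha_op_dunion_inl.
  rewrite (@Aalpha_op_complete _ _ _ _ (k / (e + k))) //.
  rewrite /= sum_const_card card_ord -/S -/M /k; field.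
  by rewrite -/k gt_eqF.
- rewrite Aalpha_op_join_inr Aalpha_op_dunion_inr.
  rewrite (@Aalpha_op_complete _ _ _ _ (k / (e + (M - 1 + k)))) //.
  rewrite /= sum_const_card card_ord -/S /k; field.
  by rewrite -/k gt_eqF.
Qed.

(** * Proper spanning subgraphs and the small degree case *)

(** Each edge of [H] missing in [G] contributes a positive term to the operator of [H]. So [w \o f]
    is a supersolution on [G], strict at an end of a missing edge, which exists by
    non-isomorphism. *)
Lemma rho_lt_spanning (R : realType) (alpha lambda : R) (G H : sgraph)
    (w : H -> R) (f : G -> H) :
  0 <= alpha -> alpha < 1 -> 0 < lambda -> connected_graph G ->
  bijective f -> (forall x y, adj x y -> adj (f x) (f y)) ->
  (forall x, 0 < w x) -> (forall x, Aalpha_op alpha w x <= lambda * w x) ->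
  ~ isomorphic G H -> rho G alpha < lambda.
Proof.
move=> a0 a1 l0 Gc fb fh w0 wl niso.
pose F x y := alpha * w (f x) + (1 - alpha) * w (f y).
have F0 x y : 0 < F x y.
  by rewrite ltr_wpDl ?mulr_ge0 ?mulr_gt0 ?subr_gt0 // ltW.
have opE x : Aalpha_op alpha w (f x) = Aalpha_op alpha (w \o f) x +
    \sum_(y | adj (f x) (f y) && ~~ adj x y) F x y.
  rewrite /Aalpha_op (reindex f) /=; last exact: onW_bij.
  rewrite (bigID (fun y => adj x y)) /=; congr (_ + _).
  by apply: eq_bigl => y; apply: andb_idl => /fh.
have extra0 x : 0 <= \sum_(y | adj (f x) (f y) && ~~ adj x y) F x y.
  by apply: sumr_ge0 => y _; exact: ltW.
apply: (@rho_lt_connected _ _ _ _ (w \o f)) => //= [x|].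
  by have := wl (f x); have := extra0 x; rewrite opE /=; lra.
have [/existsP[x /existsP[y xy]]|/existsPn nE] :=
  boolP [exists x, exists y, adj (f x) (f y) && ~~ adj x y]; last first.
  case: niso; exists f => // x y; apply/idP/idP => [fxy|/fh//].
  by have /existsPn/(_ y) := nE x; rewrite fxy /= negbK.
exists x; apply: lt_le_trans (wl (f x)); rewrite opE ltrDl.
by rewrite (bigD1 y) //= ltr_pwDl // sumr_ge0 // => z _; exact: ltW.
Qed.

Lemma exists_setS_card (T : finType) (A B : {set T}) (k : nat) :
  A \subset B -> (#|A| <= k <= #|B|)%N ->
  exists C : {set T}, [/\ A \subset C, C \subset B & #|C| = k].
Proof.
move=> AB /andP[Ak kB].
exists (A :|: [set x in take (k - #|A|) (enum (B :\: A))]); split.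
- exact: finset.subsetUl.
- rewrite finset.subUset AB /=.
  apply/fintype.subsetP => x; rewrite inE => /mem_take.
  by rewrite mem_enum inE => /andP[].
rewrite cardsU (_ : _ :&: _ = finset.set0).
  rewrite cards0 subn0 cardsE (card_uniqP _); last exact/take_uniq/enum_uniq.
  rewrite size_takel ?subnKC // -cardE cardsD.
  by rewrite (finset.setIidPr AB) leq_sub2r.
apply/eqP; rewrite -finset.subset0; apply/fintype.subsetP => x.
rewrite !inE => /andP[xA /mem_take]; rewrite mem_enum inE xA //.
Qed.

Lemma ord_injection (T : finType) (A : {set T}) (m : nat) :
  (0 < m)%N -> (#|A| <= m)%N -> exists h : T -> 'I_m, {in A &, injective h}.
Proof.
(* Off [A] the index may be out of range, where [inord] returns a default; injectivity is claimed on
   [A] only. *)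
case: m => // m _ Am; exists (fun x => inord (index x (enum A))).
move=> x y xA yA /(congr1 val).
have lt z : z \in A -> (index z (enum A) < m.+1)%N.
  by move=> zA; apply: leq_trans Am; rewrite cardE index_mem mem_enum.
rewrite /= !inordK ?lt // => /(congr1 (nth x (enum A))).
by rewrite !nth_index ?mem_enum.
Qed.

(** The vertex [v] goes to [K_1], a set [A] of exactly [s] vertices containing its neighbours to
    [K_s], the rest to [K_m]. The target lacks only edges between [K_1] and [K_m], and [v] has no
    neighbour outside [A]. *)
Lemma embedding_small_degree (G : sgraph) (v : G) (s m : nat) :
  (0 < s)%N -> (0 < m)%N -> #|G| = (s + m + 1)%N -> (degree v <= s)%N ->
  exists2 f : G -> join_graph (complete_graph s)
      (dunion_graph (complete_graph m) (complete_graph 1)),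
    bijective f & forall x y, adj x y -> adj (f x) (f y).
Proof.
move=> s0 m0 Gn vs.
have cardv : #|[set~ v]| = (s + m)%N.
  by have := cardsC1 v; rewrite Gn addn1.
have [||A [vA Av As]] := @exists_setS_card G [set y | adj v y] [set~ v] s.
- apply/fintype.subsetP => y; rewrite !inE.
  by case: eqP => // ->; rewrite adj_irr.
- by rewrite cardv leq_addr andbT.
have [h hI] := @ord_injection G A s s0 (eq_leq As).
have [|k kI] := @ord_injection G ([set~ v] :\: A) m m0.
  by rewrite cardsD (finset.setIidPr Av) cardv As addKn.
have vnA : v \notin A by apply/negP => /(fintype.subsetP Av); rewrite !inE eqxx.
pose f x : join_graph (complete_graph s)
      (dunion_graph (complete_graph m) (complete_graph 1)) :=
  if x == v then inr (inr ord0) else if x \in A then inl (h x)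
  else inr (inl (k x)).
have fI : injective f.
  move=> x y; rewrite /f.
  case: eqP => [->|/eqP xv]; case: eqP => [->|/eqP yv] //;
    case: ifPn => xA //; try case: ifPn => yA //.
  - by move=> [/hI ->].
  - by move=> [/kI ->] //; rewrite !inE ?xA ?yA ?xv ?yv.
exists f.
  apply: inj_card_bij => //.
  by rewrite !card_sum !card_ord Gn addnA.
move=> x y xy.
have : f x != f y.
  by rewrite (inj_eq fI); apply: contraTneq xy => ->; rewrite adj_irr.
have inA z : adj v z -> z \in A.
  by move=> vz; apply: (fintype.subsetP vA); rewrite inE.
rewrite /f; case: (eqVneq x v) xy => [->|_] xy.
  by case: ifP => _; rewrite ?eqxx // (inA _ xy).
case: (eqVneq y v) xy => [->|_] xy; first by rewrite (inA x) // adj_sym.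
by case: ifP => _; case: ifP => _ //=; apply: contra_neq => ->.
Qed.

(** * Degrees and components *)

(** The vertex [x], its neighbours and [D] are pairwise disjoint. *)
Lemma degree_add_le (H : sgraph) (x : H) (D : {set H}) :
  (forall y, y \in D -> ~~ connect (@adj H) x y) ->
  (degree x + #|D| + 1 <= #|H|)%N.
Proof.
move=> nD; rewrite addnAC.
have <- : #|x |: [set y | adj x y]| = (degree x + 1)%N.
  by rewrite cardsU1 inE adj_irr addnC.
rewrite -cardsUI (_ : _ :&: D = finset.set0); last first.
  apply/eqP; rewrite -finset.subset0; apply/fintype.subsetP => y; rewrite !inE.
  by case/andP=> [/orP[/eqP->|/connect1 xy] /nD]; rewrite ?connect0 ?xy.
by rewrite cards0 addn0 max_card.
Qed.

(** One representative of every component other than that of [x] serves as [D]. *)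
Lemma degree_add_components (H : sgraph) (x : H) :
  (degree x + components H <= #|H|)%N.
Proof.
have cs : connect_sym (@adj H) by apply/sym_connect_sym/adj_sym.
pose rx := fingraph.root (@adj H) x.
pose D := [set y | roots (@adj H) y] :\ rx.
have -> : components H = (#|D| + 1)%N.
  have -> : components H = #|[set y | roots (@adj H) y]|.
    by apply: eq_card => y; rewrite !inE andbT.
  by rewrite (cardsD1 rx) inE roots_root // addnC.
rewrite addnA; apply: degree_add_le => y; rewrite !inE => /andP[yx /eqP yr].
by rewrite -root_connect // yr eq_sym.
Qed.

Lemma components_le_card (H : sgraph) : (components H <= #|H|)%N.
Proof. exact: max_card. Qed.

(** Without isolated vertices, another component contains two adjacent vertices, which serve as [D].
    This gains one over the component count when there are two components. *)
Lemma degree_add3 (H : sgraph) (x : H) :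
  (forall y : H, 0 < degree y)%N -> (2 <= components H)%N ->
  (degree x + 3 <= #|H|)%N.
Proof.
move=> deg0 c2.
have cs : connect_sym (@adj H) by apply/sym_connect_sym/adj_sym.
have [y xy] : exists y, ~~ connect (@adj H) x y.
  move/card_gt1P: c2 => [y [z [/andP[/eqP yr _] /andP[/eqP zr _] yz]]].
  case: (boolP (connect (@adj H) x y)) => xy; last by exists y.
  exists z; apply: contraNN yz => xz.
  by rewrite -yr -zr root_connect // (connect_trans _ xz) // cs.
have /card_gt0P[z] := deg0 y; rewrite inE => yz.
have yNz : y != z by apply: contraTneq yz => ->; rewrite adj_irr.
have := @degree_add_le H x [set y; z]; rewrite cards2 yNz -addnA; apply => u.
rewrite !inE => /orP[] /eqP-> //; apply: contraNN xy => xz.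
by apply: connect_trans xz _; apply: connect1; rewrite adj_sym.
Qed.

Lemma card_delete (G : sgraph) (S : {set G}) : #|delete S| = #|~: S|.
Proof. by rewrite card_sig; apply: eq_card => x; rewrite !inE. Qed.

Lemma degree_delete (G : sgraph) (S : {set G}) (x : delete S) :
  degree x = #|[set y | adj (val x) y] :\: S|.
Proof.
rewrite /degree -(card_imset _ val_inj); apply: eq_card => y.
rewrite !inE; apply/imsetP/andP => [[z zx ->]|[yS xy]].
  by rewrite (valP z); move: zx; rewrite inE.
by exists (exist _ y yS); rewrite ?inE.
Qed.

Lemma degree_le_delete (G : sgraph) (S : {set G}) (x : delete S) :
  (degree (val x) <= #|S| + degree x)%N.
Proof.
rewrite degree_delete {1}/degree -(cardsID S) leq_add2r.
by apply: subset_leq_card; exact: finset.subsetIr.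
Qed.

(** With weights 1 on [S] and [1 - u] off [S], the required inequality follows from [1 < N * b * u]
    on [S] and from [u * (D + b * s) < D] off [S]. *)
Lemma rho_lt_separated (R : realType) (alpha : R) (G : sgraph) (S : {set G})
    (d : nat) :
  0 <= alpha -> alpha < 3 / 4 -> (0 < d)%N ->
  (4 * d + #|S| <= #|~: S| * d)%N ->
  (forall x : delete S, degree x + d + 2 <= #|~: S|)%N ->
  rho G alpha < #|G|%:R - 2.
Proof.
move=> a0 a34 d0 dN degN.
have GE : #|G| = (#|S| + #|~: S|)%N by rewrite cardsC.
have N4 : (4 <= #|~: S|)%N by nia.
have dN' : 4 * d%:R + #|S|%:R <= #|~: S|%:R * d%:R :> R.
  by rewrite -!natrM -natrD ler_nat.
have N4' : 4 <= #|~: S|%:R :> R by rewrite (ler_nat _ 4).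
have d0' : 1 <= d%:R :> R by rewrite ler1n.
have s0' : 0 <= #|S|%:R :> R by [].
rewrite GE natrD; set s : R := #|S|%:R in dN' s0' *.
set N : R := #|~: S|%:R in dN' N4' *; set D : R := d%:R in d0' dN'.
pose b := 1 - alpha; have b14 : 1 / 4 < b by rewrite /b; lra.
have b1 : b <= 1 by rewrite /b; lra.
have bs0 : 0 <= b * s by rewrite mulr_ge0 //; lra.
have Db0 : 0 < D + b * s by lra.
have Nb0 : 0 < N * b by rewrite mulr_gt0 //; lra.
(* The first bound on [u] is the strict inequality for [w] on [S], the second
   one that off [S]; they are compatible because [1 / b < 4]. *)
have [u u1 u2] : exists2 u, (N * b)^-1 < u & u < D / (D + b * s).
  have : (N * b)^-1 < D / (D + b * s).
    rewrite -[X in X < _]mul1r ltr_pdivrMr // mulrAC ltr_pdivlMr // mul1r.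
    have : b * (4 * D + s) <= b * (N * D) by rewrite ler_pM2l //; lra.
    have : 1 * D < 4 * b * D by rewrite ltr_pM2r; lra.
    lra.
  move=> lt; exists (((N * b)^-1 + D / (D + b * s)) / 2); lra.
have u0 : 0 < u by apply: lt_trans u1; rewrite invr_gt0.
have Nu : 1 < N * b * u by rewrite mulrC -ltr_pdivrMr // mul1r.
have Du : u * (D + b * s) < D by rewrite -ltr_pdivlMr.
have u1' : u < 1.
  rewrite ltNge; apply/negP => h.
  have : 1 * (D + b * s) <= u * (D + b * s) by rewrite ler_pM2r.
  lra.
pose w x : R := if x \in S then 1 else 1 - u.
have w0 x : 0 < w x by rewrite /w; case: ifP => _; lra.
have opE x : Aalpha_op alpha w x =
    #|[set y | adj x y] :&: S|%:R * (alpha * w x + b) +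
    #|[set y | adj x y] :\: S|%:R * (alpha * w x + b * (1 - u)).
  rewrite /Aalpha_op (bigID (mem S)) /=; congr (_ + _).
    rewrite (eq_bigr (fun=> alpha * w x + b)); last first.
      by move=> y /andP[_ yS]; rewrite /w yS mulr1.
    rewrite sumr_const -[LHS]mulr_natl; congr (_%:R * _).
    by apply: eq_card => y; rewrite !inE.
  rewrite (eq_bigr (fun=> alpha * w x + b * (1 - u))); last first.
    by move=> y /andP[_ yS]; rewrite /w (negbTE yS).
  rewrite sumr_const -[LHS]mulr_natl; congr (_%:R * _).
  by apply: eq_card => y; rewrite !inE andbC.
have b0 : 0 <= b by lra.
have u0' : 0 <= 1 - u by lra.
have bu0 : 0 <= b * (1 - u) by rewrite mulr_ge0.
have au0 : 0 <= alpha * (1 - u) by rewrite mulr_ge0.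
have strict x : Aalpha_op alpha w x < (s + N - 2) * w x.
  rewrite opE /w; case: ifPn => xS.
    (* Not being its own neighbour, [x] saves one of the 2 in [s + N - 2]; [1 < N * b * u] saves the
       other. *)
    have hS : #|[set y | adj x y] :&: S|%:R <= s - 1.
      rewrite lerBrDr -(natrD _ _ 1) ler_nat addn1; apply: proper_card.
      apply/properP; split; first exact: finset.subsetIr.
      by exists x => //; rewrite !inE adj_irr.
    have hN : #|[set y | adj x y] :\: S|%:R <= N.
      rewrite ler_nat; apply: subset_leq_card; rewrite finset.setDE.
      exact: finset.subsetIr.
    rewrite !mulr1 (_ : alpha + b = 1) ?mulr1; last by rewrite /b; lra.
    have : #|[set y | adj x y] :\: S|%:R * (alpha + b * (1 - u)) <=
        N * (alpha + b * (1 - u)) by apply: ler_wpM2r => //; lra.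
    have -> : alpha = 1 - b by rewrite /b; lra.
    lra.
  have hS : #|[set y | adj x y] :&: S|%:R <= s.
    by rewrite ler_nat; apply: subset_leq_card; exact: finset.subsetIr.
  have hN : #|[set y | adj x y] :\: S|%:R + D + 2 <= N.
    have := degN (exist _ x xS).
    by rewrite degree_delete -(ler_nat R) !natrD.
  have h1 : #|[set y | adj x y] :&: S|%:R * (alpha * (1 - u) + b) <=
      s * (alpha * (1 - u) + b) by apply: ler_wpM2r => //; lra.
  have h2 : #|[set y | adj x y] :\: S|%:R * (alpha * (1 - u) + b * (1 - u)) <=
      (N - D - 2) * (1 - u).
    rewrite -mulrDl (_ : alpha + b = 1) ?mul1r; last by rewrite /b; lra.
    by apply: ler_wpM2r => //; lra.
  move: h1 h2; have -> : alpha = 1 - b by rewrite /b; lra.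
  lra.
apply: (@rho_lt_strict _ _ _ _ w) => // [|x|]; last by lra.
  by lra.
exact: ltW.
Qed.

Theorem theorem1p2 (R : realType) (alpha : R) (t n : nat) (G : sgraph)
    (alpha_ge : 1 / 2 <= alpha) (alpha_lt : alpha < 3 / 4)
    (t_gt0 : (0 < t)%N)
    (G_connected : connected_graph G)
    (G_order : #|G| = n)
    (n_large : Num.max (5 * t%:R ^+ 2 + 10 * t%:R + 1)
                 ((12 * t%:R * (1 - alpha) - 2 * alpha + 1) / (3 - 4 * alpha))
               <= n%:R)
    (rho_ge : rho (extremal n t) alpha <= rho G alpha) :
  ~ isomorphic G (extremal n t) -> tough (t%:R : R) G.
Proof.
move=> niso S c2; rewrite -natrM ler_nat leqNgt; apply/negP => St.
have nt : (5 * t ^ 2 + 10 * t + 1 <= n)%N.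
  move: n_large; rewrite ge_max => /andP[+ _].
  by rewrite -(ler_nat R) !natrD !natrM; lra.
have a0 : 0 <= alpha by lra.
have a1 : alpha < 1 by lra.
have s0 : (0 < 2 * t - 1)%N by lia.
have m0 : (0 < n - 2 * t)%N by nia.
have nE : n = (2 * t - 1 + (n - 2 * t) + 1)%N by nia.
have [lambda [w [lambda_ge w0 wE]]] := @join_perron R alpha _ _ a0 a1 s0 m0.
have n2 : n%:R - 2 <= lambda.
  by apply: le_trans lambda_ge; rewrite {1}nE !natrD; lra.
have n16 : 16 <= n%:R :> R by rewrite (ler_nat _ 16); nia.
have lambda0 : 0 < lambda by lra.
have lambda_le : lambda <= rho (extremal n t) alpha.
  apply: eigenvalue_le_rho => //; apply/eigenvalue_AalphaP; exists w => //.
  by exists (inl (Ordinal s0)); rewrite gt_eqF.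
suff : rho G alpha < lambda.
  by rewrite ltNge (le_trans lambda_le).
have [/existsP[v deg_v]|/existsPn deg_gt] :=
    boolP [exists v : G, degree v <= 2 * t - 1]%N.
  have [|f fbij fhom] := @embedding_small_degree G v _ _ s0 m0 _ deg_v.
    by rewrite G_order.
  by apply: (@rho_lt_spanning _ _ _ _ _ w f) => // x; rewrite wE.
apply: lt_le_trans n2; rewrite -G_order.
have cardS := cardsC S; rewrite G_order in cardS.
have cN := components_le_card (delete S); rewrite card_delete in cN.
apply: (@rho_lt_separated _ _ _ S (maxn 1 (components (delete S) - 2))) => //.
- by rewrite leq_max.
(* Put [N = #|~: S|]. From [#|S| < t * c] and [c <= N] follows [n < (t + 1) * N], so the quadratic
   bound on [n] makes [N] large. If [d >= 2], then [(N - 4) * d >= 2 * t * d >= t * (d + 2) > #|S|];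
   if [d = 1], then [#|S| < 3 * t] is small against [n]. *)
- have N_ge : (2 * t + 4 <= #|~: S|)%N by nia.
  by nia.
move=> x; rewrite -card_delete.
have := degree_add_components _ x.
have [c3|c3] := leqP 3 (components (delete S)); first by lia.
(* Here [c = 2], so [#|S| < 2 * t]. All degrees in [G] are at least [2 * t], hence [G - S] has no
   isolated vertex. *)
move=> _; suff : (degree x + 3 <= #|delete S|)%N by lia.
apply: degree_add3 => // y.
by have := degree_le_delete _ _ y; have := deg_gt (val y); nia.
Qed.
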